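(* Let $c,C>0$ be constants, independent of $h$, $p$ and $\mathcal{D}$, such that for all $p,h,\mathcal{D}$ and all $v_h\in S_{p,h,\mathcal{D}}$, with $v_h=v_h^{reg}+v_h^{out}$, $v_h^{reg}\in S^{reg}_{p,h,\mathcal{D}}$, $v_h^{out}\in S^{out}_{p,h,\mathcal{D}}$, $$ c \left( | v_{h}^{reg} |_{H^1(0,1)}^2 + | v_{h}^{out} |_{H^1(0,1)}^2 \right) \leq | v_h |_{H^1(0,1)}^2 \leq C \left( | v_{h}^{reg} |_{H^1(0,1)}^2 + | v_{h}^{out} |_{H^1(0,1)}^2 \right) $$ (such constants exist). Let $\widetilde{K} = \widetilde{Q}^{-\top} \widetilde{\Lambda} \widetilde{Q}^{-1}$. Then $$ c \, \mathbf v^{\top} \widetilde{K} \mathbf v \leq \mathbf v^{\top} K \mathbf v \leq C \, \mathbf v^{\top} \widetilde{K} \mathbf v \qquad \text{for all } \mathbf v \in \mathbb{R}^m. $$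
   Context: Let $p\ge 1$, $n\ge1$ be integers, $h=1/n$, and $\mathcal{D}\subseteq\{0,1\}$. $\pi_p$ denotes polynomials of degree at most $p$. $S_{p,h} = \{ v\in C^{p-1}[0,1] : v|_{[(k-1)h,kh]}\in\pi_p,\ k=1,\dots,n\}$ and $S_{p,h,\mathcal{D}}=\{v\in S_{p,h} : v(x)=0 \text{ for } x\in\mathcal{D}\}$, $m=\dim S_{p,h,\mathcal{D}}$. $S_{p,h,\mathcal{D}}^{reg}$ is the subspace of those $v\in S_{p,h,\mathcal{D}}$ with $\partial^{2k}v(x)=0$ for $x\in\mathcal{D}$, $k=1,\dots,\lfloor\frac{p-1}{2}\rfloor$, and $\partial^{2k+1}v(x)=0$ for $x\in\{0,1\}\setminus\mathcal{D}$, $k=0,\dots,\lfloor\frac p2\rfloor-1$. $S_{p,h,\mathcal{D}}^{out}$ is its $L^2(0,1)$-orthogonal complement in $S_{p,h,\mathcal{D}}$. Let $n_{reg}$, $n_{out}$ be the dimensions of these two spaces. $|v|_{H^1(0,1)}=\|v'\|_{L^2(0,1)}$. Let $B_1,\dots,B_m$ be the standard B-spline basis of $S_{p,h,\mathcal{D}}$ (B-splines of the open uniform knot vector, with those not vanishing on $\mathcal{D}$ removed), and let $M,K\in\mathbb{R}^{m\times m}$ be the mass and stiffness matrices, $M_{ij}=\int_0^1B_jB_i\,dx$, $K_{ij}=\int_0^1B_j'B_i'\,dx$. $V_{reg}\in\mathbb{R}^{m\times n_{reg}}$ and $V_{out}\in\mathbb{R}^{m\times n_{out}}$ are matrices whose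 columns are the coordinate vectors (with respect to $B_1,\dots,B_m$) of a basis of $S^{reg}_{p,h,\mathcal{D}}$ and $S^{out}_{p,h,\mathcal{D}}$, respectively. For $\ast\in\{reg,out\}$, $Q_\ast\in\mathbb{R}^{n_\ast\times n_\ast}$ and the diagonal matrix $\Lambda_\ast\in\mathbb{R}^{n_\ast\times n_\ast}$ give a generalized eigendecomposition $$Q_\ast^\top(V_\ast^\top KV_\ast)Q_\ast=\Lambda_\ast,\qquad Q_\ast^\top(V_\ast^\top MV_\ast)Q_\ast=I.$$ Define $$\widetilde Q=\begin{bmatrix}V_{reg}&V_{out}\end{bmatrix}\begin{bmatrix}Q_{reg}&0\\0&Q_{out}\end{bmatrix},\qquad \widetilde\Lambda=\begin{bmatrix}\Lambda_{reg}&0\\0&\Lambda_{out}\end{bmatrix}.$$ *)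

(* Defs.v *)
From HB Require Import structures.
From mathcomp Require Import all_boot all_order all_algebra.
From mathcomp Require Import all_classical all_reals all_analysis.

Set Implicit Arguments.
Unset Strict Implicit.
Unset Printing Implicit Defensive.

Import Order.TTheory GRing.Theory Num.Theory.
Import numFieldNormedType.Exports.

Local Open Scope classical_set_scope.
Local Open Scope ring_scope.

(** Functions on [0,1] are represented by functions [R -> R] of which only the
    values on [0,1] matter: every notion below depends on those values only. *)

Section Interval.
Variable R : realType.
Implicit Types (f g v : R -> R) (x : R).

Definition diffq f x : R -> R := fun y => (f y - f x) / (y - x).

(** Derivative relative to [0,1]: one-sided at 0 and at 1. *)
Definition nbhs01 x : set_system R := within `[0, 1] x^'.

Definition der f : R -> R := fun x => lim (diffq f x @ nbhs01 x).

Definition dern (k : nat) f : R -> R := iter k der f.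

Definition Ck01 (k : nat) f : Prop :=
  (forall j x, (j < k)%N -> 0 <= x <= 1 -> cvg (diffq (dern j f) x @ nbhs01 x))
  /\ {within `[0, 1], continuous (dern k f)}.

Definition L2dot f g : R :=
  Rintegral (@lebesgue_measure R) `[0, 1] (fun x => f x * g x).

(** For a continuous piecewise polynomial [v] the classical derivative exists
    off the finite set of breakpoints; the arbitrary value of [der v] there does
    not affect the integral. *)
Definition H1semi v : R := Num.sqrt (L2dot (der v) (der v)).

(** Two functions are identified when they agree on [0,1]; [S] then has
    dimension [k]. *)
Definition is_basis (S : set (R -> R)) (k : nat) (f : 'I_k -> R -> R) : Prop :=
  [/\ forall j, S (f j),
      forall a : 'I_k -> R,
        (forall x, 0 <= x <= 1 -> \sum_j a j * f j x = 0) -> forall j, a j = 0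
    & forall v, S v -> exists a : 'I_k -> R,
        forall x, 0 <= x <= 1 -> v x = \sum_j a j * f j x].

End Interval.

Section Splines.
Variables (R : realType) (p n : nat).

Definition spline : set (R -> R) := [set v |
  Ck01 p.-1 v /\
  forall k, (k < n)%N -> exists q : {poly R}, (size q <= p.+1)%N /\
    forall x, k%:R / n%:R <= x <= k.+1%:R / n%:R -> v x = q.[x]].

Definition splineD (D : set R) : set (R -> R) :=
  [set v | spline v /\ forall x, D x -> v x = 0].

Definition spline_reg (D : set R) : set (R -> R) := [set v |
  [/\ splineD D v,
      forall k x, (1 <= k <= p.-1./2)%N -> D x -> dern k.*2 v x = 0
    & forall k x, (k < p./2)%N -> ([set 0; 1] `\` D) x -> dern k.*2.+1 v x = 0]].

Definition spline_out (D : set R) : set (R -> R) := [set v |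
  splineD D v /\ forall w, spline_reg D w -> L2dot v w = 0].

(** Open uniform knot vector: [0] (p+1 times), [1/n, ..., (n-1)/n], [1] (p+1
    times), indexed by [0, ..., n + 2p]; the subtraction is truncated. *)
Definition knot (i : nat) : R := (minn (i - p) n)%:R / n%:R.

(** Cox-de Boor recursion; the convention [0 / 0 = 0] is the one of MathComp's
    [_^-1]. The last nonempty knot span is closed at [1], so that the B-splines
    are left-continuous there. *)
Fixpoint cox_de_boor (q i : nat) (x : R) : R :=
  match q with
  | 0 => if (knot i <= x < knot i.+1)
            || [&& knot i < knot i.+1, knot i.+1 == 1 & x == 1] then 1 else 0
  | q'.+1 =>
      (x - knot i) / (knot (i + q) - knot i) * cox_de_boor q' i x +
      (knot (i + q).+1 - x) / (knot (i + q).+1 - knot i.+1)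
        * cox_de_boor q' i.+1 x
  end.

Variable D : set R.

Definition kept : {set 'I_(n + p)} :=
  [set i : 'I_(n + p) | `[< forall x, D x -> cox_de_boor p i x = 0 >]]%SET.

Definition mdim : nat := #|kept|.

Definition bspline (j : 'I_mdim) : R -> R := cox_de_boor p (enum_val j).

Definition massmx : 'M[R]_mdim := \matrix_(i, j) L2dot (bspline j) (bspline i).

Definition stiffmx : 'M[R]_mdim :=
  \matrix_(i, j) L2dot (der (bspline j)) (der (bspline i)).

Definition of_coord (k : nat) (V : 'M[R]_(mdim, k)) (j : 'I_k) : R -> R :=
  fun x => \sum_i V i j * bspline i x.

End Splines.

Definition gen_eigendecomp (R : realType) (m k : nat) (K M : 'M[R]_m)
    (V : 'M[R]_(m, k)) (Q L : 'M[R]_k) : Prop :=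
  [/\ is_diag_mx L,
      Q^T *m (V^T *m K *m V) *m Q = L
    & Q^T *m (V^T *m M *m V) *m Q = 1%:M].

(* Main.v *)
Require Import Defs.
From HB Require Import structures.
From mathcomp Require Import all_boot all_order all_algebra.
From mathcomp Require Import all_classical all_reals all_analysis.
From mathcomp Require Import measurable_realfun ring lra zify.

(** The coordinate vectors of [S^reg] and [S^out] are [M]-orthogonal, so that
    [Qt^T M Qt = 1] and [Qt^T M] is a left inverse of [Qt]. It is also a right
    inverse because [Qt] is onto: given [a], subtracting from the spline with
    coordinates [a] its orthogonal projection on [S^reg] leaves a spline of
    [S^out], and B-spline coordinates are unique. For [v = Qt y],
    [v^T Kt v = y^T Lt y] is the sum of the squared H1 seminorms of the two
    components of the spline with coordinates [v], and [stable] applies.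
    This rests on three facts about B-splines of degree [p]: they are
    C^(p-1) at the simple interior knots, they are linearly independent, and
    their derivatives are piecewise polynomial. All of them are read off the
    polynomials to which the Cox-de Boor recursion restricts on a knot span. *)

Set Implicit Arguments.
Unset Strict Implicit.
Unset Printing Implicit Defensive.

Import Order.TTheory GRing.Theory Num.Theory.
Import numFieldNormedType.Exports.

Local Open Scope classical_set_scope.
Local Open Scope ring_scope.

(** * B-splines restricted to a knot span *)

Section Piece.
Variables (R : realFieldType) (t : nat -> R).
Hypothesis t_mono : {homo t : i j / (i <= j)%N >-> i <= j}.

(** The polynomial that agrees with the [i]-th B-spline of degree [q] on the span
    [[t s, t s.+1)]. *)
Fixpoint bpiece (s q i : nat) : {poly R} :=
  match q with
  | 0 => (i == s)%:R
  | q'.+1 =>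
      (t (i + q) - t i)^-1 *: (('X - (t i)%:P) * bpiece s q' i) +
      (t (i + q).+1 - t i.+1)^-1 *: (((t (i + q).+1)%:P - 'X) * bpiece s q' i.+1)
  end.

Lemma bpieceS s q i : bpiece s q.+1 i =
  (t (i + q.+1) - t i)^-1 *: (('X - (t i)%:P) * bpiece s q i) +
  (t (i + q.+1).+1 - t i.+1)^-1 *:
    (((t (i + q.+1).+1)%:P - 'X) * bpiece s q i.+1).
Proof. by []. Qed.

Lemma size_bpiece s q i : (size (bpiece s q i) <= q.+1)%N.
Proof.
elim: q i => [|q IH] i /=; first by case: eqP => _; rewrite ?size_poly1 ?size_poly0.
have aux (a : R) (l r : {poly R}) : (size l <= 2)%N -> (size r <= q.+1)%N ->
    (size (a *: (l * r)) <= q.+2)%N.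
  move=> hl hr; apply: leq_trans (size_scale_leq _ _) _.
  by apply: leq_trans (size_polyMleq _ _) _; lia.
apply: leq_trans (size_polyD _ _) _; rewrite geq_max; apply/andP; split;
  apply: aux => //; first by rewrite size_XsubC.
by rewrite -opprB size_polyN size_XsubC.
Qed.

Lemma bpiece_out s q i : ~~ (i <= s <= i + q)%N -> bpiece s q i = 0.
Proof.
elim: q i => [|q IH] i /= si.
  by case: eqP si => // ->; rewrite addn0 leqnn.
by rewrite !IH ?mulr0 ?scaler0 ?addr0 //; move: si; lia.
Qed.

(** Induction on [q]: after the product rule and the induction hypothesis, only a multiple of the
    middle B-spline [bpiece s q i.+1] is left over, and [key] cancels it. Repeated knots are covered
    because a zero knot difference has inverse 0. *)
Lemma deriv_bpiece s q i : (bpiece s q.+1 i)^`() =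
  q.+1%:R *: ((t (i + q.+1) - t i)^-1 *: bpiece s q i
              - (t (i + q.+1).+1 - t i.+1)^-1 *: bpiece s q i.+1).
Proof.
have derivE r (j : nat) : (bpiece s r.+1 j)^`() =
    (t (j + r.+1) - t j)^-1 *: (bpiece s r j + ('X - (t j)%:P) * (bpiece s r j)^`())
    + (t (j + r.+1).+1 - t j.+1)^-1 *:
       (((t (j + r.+1).+1)%:P - 'X) * (bpiece s r j.+1)^`() - bpiece s r j.+1).
  rewrite bpieceS derivD !derivZ !derivM derivXsubC.
  rewrite derivB derivC derivX sub0r mul1r mulN1r; congr (_ + _ *: _).
  by rewrite addrC.
elim: q i => [|q IH] i.
  have d0 j : (bpiece s 0 j)^`() = 0 by rewrite /=; case: eqP; rewrite (derivC 1, derivC 0).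
  by rewrite derivE !d0 !mulr0 addr0 sub0r scale1r scalerN.
rewrite derivE !IH /=.
rewrite -!mul_polyC !addnS !addSn.
set a := ((t (i + q).+2 - t i)^-1)%:P.
set b := ((t (i + q).+3 - t i.+1)^-1)%:P.
set d := ((t (i + q).+2 - t i.+1)^-1)%:P.
(* Both sides are [d] when [d != 0]; coinciding knots give [d = 0]. *)
have key : a * ((t (i + q).+2)%:P - (t i)%:P) * d = b * ((t (i + q).+3)%:P - (t i.+1)%:P) * d.
  rewrite /a /b /d -!polyCB -!polyCM; congr (_%:P).
  have [->|dn0] := eqVneq (t (i + q).+2 - t i.+1) 0; first by rewrite invr0 !mulr0.
  have lt : t i.+1 < t (i + q).+2.
    by rewrite lt_neqAle -subr_eq0 -opprB oppr_eq0 dn0 t_mono //; lia.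
  have l1 : t i <= t i.+1 by rewrite t_mono.
  have l2 : t (i + q).+2 <= t (i + q).+3 by rewrite t_mono.
  by rewrite !mulVf //; lra.

have -> : (q.+2%:R : R)%:P = (q.+1%:R : R)%:P + 1 by rewrite -natr1 polyCD.
apply/subr0_eq; transitivity ((q.+1%:R : R)%:P * bpiece s q i.+1 *
  (b * ((t (i + q).+3)%:P - (t i.+1)%:P) * d - a * ((t (i + q).+2)%:P - (t i)%:P) * d)).
  ring.
by rewrite key subrr mulr0.
Qed.

Section Span.
Variable s : nat.
Hypothesis t_lt : t s < t s.+1.

Lemma span_lt i j : (i <= s)%N -> (s < j)%N -> t i < t j.
Proof. by move=> si sj; apply: le_lt_trans (lt_le_trans t_lt _); apply: t_mono. Qed.

(** Reindexing leaves no boundary terms: on span [s] the B-splines of index 0 and [s.+1] vanish, the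
    former because [q < s]. The truncated index in [b 0.-1] is therefore harmless. *)
Lemma sum_shift_bpiece q (a b : nat -> {poly R}) : (q < s)%N ->
  \sum_(i < s.+1) (a i * bpiece s q i + b i * bpiece s q i.+1)
  = \sum_(i < s.+1) (a i + b i.-1) * bpiece s q i.
Proof.
move=> qs; rewrite big_split /=; under [RHS]eq_bigr do rewrite mulrDl.
rewrite big_split /=; congr (_ + _).
rewrite big_ord_recr /= [X in _ + b s * X]bpiece_out ?mulr0 ?addr0; last by lia.
rewrite [RHS]big_ord_recl /= [X in b _ * X]bpiece_out ?mulr0 ?add0r //; lia.
Qed.

(** After the index shift, the two recursion weights of a B-spline of degree [q] share a
    denominator, and their numerators add up to it. *)
Lemma bpiece_partition q : (q <= s)%N -> \sum_(i < s.+1) bpiece s q i = 1.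
Proof.
elim: q => [|q IH] qs.
  rewrite (bigD1 ord_max) //= eqxx big1 ?addr0 // => i /eqP ne /=.
  by case: eqP => // e; case: ne; apply/val_inj.
rewrite -[RHS]IH 1?ltnW //=; under eq_bigr do rewrite !scalerAl.
rewrite (sum_shift_bpiece (fun i => (t (i + q.+1) - t i)^-1 *: ('X - (t i)%:P))
  (fun i => (t (i + q.+1).+1 - t i.+1)^-1 *: ((t (i + q.+1).+1)%:P - 'X))) //.
apply: eq_bigr => -[[|i] /= si] _; first by rewrite bpiece_out ?mulr0 //; lia.
have [out|] := boolP (i.+1 <= s <= i.+1 + q)%N; last by move/bpiece_out => ->; rewrite mulr0.
have lt : t i.+1 < t (i + q).+2 by apply: span_lt; lia.
rewrite addSn addnS -scalerDr (_ : (_ - _) + (_ - _) = (t (i + q).+2)%:P - (t i.+1)%:P); last by ring.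
rewrite -polyCB -mul_polyC -polyCM mulVf ?mul1r //.
by rewrite subr_eq0 gt_eqF.
Qed.

(** Differentiating a vanishing combination shows by induction on [q] that its
    coefficients are all equal; their common value is 0 by the partition of unity. *)
Lemma bpiece_free q (a : nat -> R) : (q <= s)%N ->
  \sum_(i < s.+1) a i *: bpiece s q i = 0 ->
  forall i, (i <= s <= i + q)%N -> a i = 0.
Proof.
elim: q a => [|q IH] a qs.
  rewrite (bigD1 ord_max) //= eqxx big1 ?addr0; last first.
    move=> i /eqP ne /=; case: eqP => [e|]; last by rewrite scaler0.
    by case: ne; apply/val_inj.
  rewrite -mul_polyC mulr1 => /eqP; rewrite polyC_eq0 => /eqP a0 i.
  by rewrite addn0 -eqn_leq => /eqP ->.
move=> sum0.
(* Up to the factor [q.+1], the derivative has coefficients [(a i - a i.-1) * al i], and [al i] is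
   nonzero because span [s] lies between [t i] and [t (i + q.+1)]. *)
have step i : (i <= s <= i + q)%N -> a i = a i.-1.
  case: i => [//|i] si.
  have := congr1 (fun r => q.+1%:R^-1 *: deriv r) sum0; rewrite deriv0 scaler0.
  rewrite linear_sum scaler_sumr.
  pose al i := ((t (i + q.+1) - t i)^-1).
  under eq_bigr => j _.
    rewrite linearZ /= deriv_bpiece 2!scalerA mulrAC mulVf ?pnatr_eq0 // mul1r.
    rewrite scalerBr !scalerA -scaleNr -!mul_polyC.
    over.
  rewrite (sum_shift_bpiece (fun j => (a j * al j)%:P)
    (fun j => (- (a j * al j.+1))%:P)) //.
  rewrite (eq_bigr (fun j : 'I_s.+1 => ((a j - a j.-1) * al j) *: bpiece s q j)); last first.
    move=> -[[|j] /= sj] _; first by rewrite bpiece_out ?mulr0 ?scaler0 //; lia.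
    by rewrite -polyCD mul_polyC mulrBl.
  move=> /(IH (fun j => (a j - a j.-1) * al j) (ltnW qs))/(_ i.+1 si)/eqP.
  have lt : t i.+1 < t (i.+1 + q.+1) by apply: span_lt; lia.
  rewrite mulf_eq0 invr_eq0 !subr_eq0 (gt_eqF lt) orbF => /eqP //.
have const j : (j <= q.+1)%N -> a (s - j)%N = a s.
  elim: j => [|j IHj] jq; first by rewrite subn0.
  rewrite -[RHS]IHj 1?ltnW // [RHS]step; last by lia.
  by congr a; lia.
have eqa i : (i <= s <= i + q.+1)%N -> a i = a s.
  by move=> si; rewrite -(const (s - i)%N); [congr a|]; lia.
suff as0 : a s = 0 by move=> i /eqa ->.
move: sum0; rewrite (eq_bigr (fun i : 'I_s.+1 => a s *: bpiece s q.+1 i)); last first.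
  move=> i _; have [/eqa -> //|/bpiece_out ->] := boolP (i <= s <= i + q.+1)%N.
  by rewrite !scaler0.
by rewrite -scaler_sumr bpiece_partition // -mul_polyC mulr1 => /eqP; rewrite polyC_eq0 => /eqP.
Qed.

Hypothesis t_lt1 : t s.+1 < t s.+2.

(** C^q smoothness of the B-splines of degree [q + 1] at the simple knot
    [t s.+1]. *)
Lemma bpiece_match q j i : (j <= q)%N ->
  (bpiece s q.+1 i)^`(j).[t s.+1] = (bpiece s.+1 q.+1 i)^`(j).[t s.+1].
Proof.
elim: j q i => [|j IH] q i; last first.
  (* The derivative formula lowers the degree and the order by one. *)
  case: q => // q jq; rewrite !derivSn !deriv_bpiece !derivnZ !derivnB !derivnZ.
  by rewrite !hornerE !IH.
(* The base case is the hat function, equal to 1 at its peak [t s.+1] from both sides since neither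
   span is empty; the recursion propagates the agreement to higher degrees. *)
move=> _; rewrite !derivn0; elim: q i => [|q IH] i.
  rewrite /= !addn1 eqSS !hornerE /=.
  have bE (b : bool) : (b%:R : {poly R}).[t s.+1] = b%:R by case: b; rewrite !hornerE.
  rewrite !bE; have [->|ns] := eqVneq i s.
    rewrite (ltn_eqF (ltnSn _)) (gtn_eqF (ltnSn _)) !mulr0 !mulr1 addr0 add0r.
    by rewrite !mulVf // subr_eq0 gt_eqF.
  rewrite !mulr0 add0r addr0; have [->|ns1] := eqVneq i s.+1.
    by rewrite (gtn_eqF (ltnW _)) // subrr !(mulr0, mul0r).
  by have [->|] := eqVneq i.+1 s; rewrite ?mulr0 // subrr mulr0 mul0r.
have recE r x : (bpiece r q.+2 i).[x] =
    (t (i + q.+2) - t i)^-1 * (('X - (t i)%:P).[x] * (bpiece r q.+1 i).[x]) +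
    (t (i + q.+2).+1 - t i.+1)^-1 *
      (((t (i + q.+2).+1)%:P - 'X).[x] * (bpiece r q.+1 i.+1).[x]).
  by rewrite bpieceS; move: (bpiece r q.+1) => f; rewrite !(hornerD, hornerZ, hornerM).
by rewrite !recE !IH.
Qed.
End Span.
End Piece.

(** * Derivatives of piecewise polynomials relative to [0,1] *)

Section Relative.
Variable R : realType.
Implicit Types (f g : R -> R) (x : R).

(** Properness makes limits along [nbhs01] unique, at the endpoints too. *)
Lemma nbhs01_proper x : 0 <= x <= 1 -> ProperFilter (nbhs01 x).
Proof.
move=> x01; apply: Build_ProperFilter_ex => P; rewrite /nbhs01 /within /dnbhs.
move=> /= /nbhs_ballP[e /= e0] xe.
(* A step of at most 1/2 towards the farther endpoint stays in [0,1], and one of at most [e / 2]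
   stays in the ball. *)
pose y := if x < 1/2%:R then x + Num.min (e / 2%:R) (1/2%:R) else x - Num.min (e / 2%:R) (1/2%:R).
have m0 : 0 < Num.min (e / 2%:R) (1 / 2%:R) by rewrite lt_min; apply/andP; split; lra.
have me : Num.min (e / 2%:R) (1 / 2%:R) <= e / 2%:R by rewrite ge_min lexx.
have m1 : Num.min (e / 2%:R) (1 / 2%:R) <= 1 / 2%:R by rewrite ge_min lexx orbT.
exists y; apply: (xe y).
- rewrite /ball /= /y; case: ifP => _; rewrite ltr_norml; lra.
- rewrite /y; apply/eqP; case: ifP => _; lra.
- by rewrite /y; case: ifPn => /=; rewrite in_itv /= -?leNgt => h; lra.
Qed.

Lemma continuous01P f : {within `[0, 1], continuous f} <->
  (forall x, 0 <= x <= 1 -> f @ within `[0, 1] (nbhs x) --> f x).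
Proof.
split=> [/subspace_continuousP h x x01|h].
  by have := h x; rewrite /= in_itv /=; exact.
by apply/subspace_continuousP => x /=; rewrite in_itv; exact: h.
Qed.

(** Identities between iterated derivatives hold on [0,1] only, so they enter a difference quotient
    through this lemma and not by extensionality. *)
Lemma eq_cvg_diffq f g x (l : R) : (forall y, 0 <= y <= 1 -> f y = g y) -> 0 <= x <= 1 ->
  diffq f x @ nbhs01 x --> l -> diffq g x @ nbhs01 x --> l.
Proof.
move=> fg x01; apply: cvg_trans; apply: near_eq_cvg.
rewrite /nbhs01; near=> y.
have y01 : y \in `[0, 1] by near: y; apply: withinT.
by rewrite /diffq !fg //; move: y01; rewrite in_itv.
Unshelve. all: by end_near.
Qed.

Lemma der_cvg f x (l : R) : 0 <= x <= 1 -> diffq f x @ nbhs01 x --> l -> der f x = l.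
Proof. by move=> x01; have := nbhs01_proper x01 => ?; apply: cvg_lim. Qed.

Lemma diffq_lin f g x (a l m : R) : 0 <= x <= 1 ->
  diffq f x @ nbhs01 x --> l -> diffq g x @ nbhs01 x --> m ->
  diffq (fun y => a * f y + g y) x @ nbhs01 x --> a * l + m.
Proof.
move=> x01 fl gm; have ? := nbhs01_proper x01.
rewrite (_ : diffq _ _ = (fun y => a * diffq f x y + diffq g x y)); last first.
  by apply/funext => y; rewrite /diffq; ring.
by apply: cvgD gm; apply: cvgM fl; exact: cvg_cst.
Qed.

Lemma dern_lin k f g (a : R) : Ck01 k f -> Ck01 k g ->
  forall j x, (j <= k)%N -> 0 <= x <= 1 ->
    dern j (fun y => a * f y + g y) x = a * dern j f x + dern j g x.
Proof.
move=> [Cf _] [Cg _]; elim=> [//|j IH] x jk x01.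
apply: (der_cvg x01); apply: (eq_cvg_diffq (fun y y01 => esym (IH y (ltnW jk) y01))) => //.
by apply: diffq_lin => //; [exact: Cf|exact: Cg].
Qed.

Lemma Ck01_lin k f g (a : R) : Ck01 k f -> Ck01 k g ->
  Ck01 k (fun y => a * f y + g y).
Proof.
move=> Cf Cg; have L := dern_lin a Cf Cg; case: Cf Cg => [Cf cf] [Cg cg]; split.
  move=> j x jk x01; apply/cvg_ex; eexists.
  apply: (eq_cvg_diffq (fun y y01 => esym (L j y (ltnW jk) y01))) => //.
  by apply: diffq_lin => //; [exact: Cf|exact: Cg].
apply/continuous01P => x x01; have hf := (continuous01P _).1 cf x x01; have hg := (continuous01P _).1 cg x x01.
have h : a * dern k f y + dern k g y @[y --> within `[0, 1] (nbhs x)] -->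
    a * dern k f x + dern k g x.
  by apply: cvgD hg; apply: cvgM hf; exact: cvg_cst.
rewrite L //; apply: cvg_trans h.
apply: near_eq_cvg; near=> y; rewrite /= L //.
by have : y \in `[0, 1] by near: y; apply: withinT.
Unshelve. all: by end_near.
Qed.

Lemma dern0 j x : 0 <= x <= 1 -> dern j (fun=> 0 : R) x = 0.
Proof.
elim: j x => [//|j IH] x x01; apply: (der_cvg x01).
apply: (eq_cvg_diffq (f := fun=> 0)) => // [y y01|]; first exact/esym/IH.
rewrite (_ : diffq _ _ = cst 0); first exact: cvg_cst.
by apply/funext => y; rewrite /diffq subrr mul0r.
Qed.

Lemma Ck01_0 k : Ck01 k (fun=> 0 : R).
Proof.
split=> [j x jk x01|].
  apply/cvg_ex; exists 0; apply: (eq_cvg_diffq (f := fun=> 0)) => // [y y01|].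
    exact/esym/dern0.
  rewrite (_ : diffq _ _ = cst 0); first exact: cvg_cst.
  by apply/funext => y; rewrite /diffq subrr mul0r.
apply/continuous01P => x x01; rewrite dern0 //; apply: cvg_near_cst; near=> y; rewrite dern0 //.
by have : y \in `[0, 1] by near: y; apply: withinT.
Unshelve. all: by end_near.
Qed.
End Relative.

Section Pieces.
Variables (R : realType) (n : nat).
Hypothesis n_gt0 : (0 < n)%N.
Implicit Types (f : R -> R) (x : R) (q : nat -> {poly R}).

Definition on_pieces q f : Prop := forall k x, (k < n)%N ->
  k%:R / n%:R <= x <= k.+1%:R / n%:R -> f x = (q k).[x].

Lemma piece_ex x : 0 <= x <= 1 -> exists2 k, (k < n)%N & k%:R / n%:R <= x <= k.+1%:R / n%:R.
Proof.
move=> /andP[x0 x1].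
have n0 : 0 < n%:R :> R by rewrite ltr0n.
have [xn|xn] := eqVneq x 1.
  exists n.-1; first by lia.
  by rewrite xn prednK // divff ?gt_eqF // lexx andbT ler_pdivrMr // mul1r ler_nat; lia.
have xlt : x < 1 by rewrite lt_neqAle xn.
have h0 : 0 <= x * n%:R by rewrite mulr_ge0 // ltW.
exists (Num.truncn (x * n%:R)).
  rewrite -(ltr_nat R); apply: le_lt_trans (_ : x * n%:R < _).
    by rewrite truncn_le.
  by rewrite gtr_pMl.
rewrite ler_pdivrMr // ler_pdivlMr // truncn_le // h0 /=.
by rewrite ltW // truncnS_gt.
Qed.

Lemma piece01 k x : (k < n)%N -> k%:R / n%:R <= x <= k.+1%:R / n%:R -> 0 <= x <= 1.
Proof.
have n0 : 0 < n%:R :> R by rewrite ltr0n.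
move=> kn /andP[h1 h2]; apply/andP; split.
  by apply: le_trans h1; rewrite divr_ge0.
by apply: le_trans h2 _; rewrite ler_pdivrMr // mul1r ler_nat.
Qed.

(** Pieces not containing [x] are avoided near [x], which spares the distinction
    between breakpoints and interior points. *)
Lemma near_piece x : 0 <= x <= 1 -> \forall y \near within `[0, 1] (nbhs x),
  exists2 k, (k < n)%N & k%:R / n%:R <= x <= k.+1%:R / n%:R
                      /\ k%:R / n%:R <= y <= k.+1%:R / n%:R.
Proof.
move=> x01.
have sep (k : 'I_n) : \forall y \near within `[0, 1] (nbhs x),
    k%:R / n%:R <= y <= k.+1%:R / n%:R -> k%:R / n%:R <= x <= k.+1%:R / n%:R.
  have [xk|xk] := boolP (k%:R / n%:R <= x <= k.+1%:R / n%:R).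
    by apply: nearW => y _.
  apply: cvg_within; move: xk; rewrite negb_and -!ltNge => /orP[xk|xk].
    near=> y; suff : y < k%:R / n%:R by move=> h1 /andP[h2 _]; lra.
    by near: y; exact: lt_nbhsl.
  near=> y; suff : k.+1%:R / n%:R < y by move=> h1 /andP[_ h2]; lra.
  by near: y; exact: lt_nbhsr.
have all_sep := filter_forall _ sep; near=> y.
have h : forall k : 'I_n, k%:R / n%:R <= y <= k.+1%:R / n%:R ->
  k%:R / n%:R <= x <= k.+1%:R / n%:R by near: y; exact: all_sep.
have y01 : 0 <= y <= 1.
  by have : y \in `[0, 1] by near: y; apply: withinT.
by have [k kn ky] := piece_ex y01; exists k => //; split => //; apply: (h (Ordinal kn)).
Unshelve. all: by end_near.
Qed.

(** Common core of continuity and differentiability: [F] is the full or the punctured neighbourhood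
    filter within [0,1]. As there are finitely many pieces, one estimate per piece containing [x]
    suffices. *)
Lemma on_pieces_cvg q f (l : R) x (F : set_system R) : Filter F ->
  F --> within `[0, 1] (nbhs x) -> 0 <= x <= 1 ->
  (forall k, (k < n)%N -> k%:R / n%:R <= x <= k.+1%:R / n%:R -> (q k).[x] = l) ->
  (\forall y \near F, forall k, (k < n)%N ->
     k%:R / n%:R <= x <= k.+1%:R / n%:R -> k%:R / n%:R <= y <= k.+1%:R / n%:R ->
     f y = (q k).[y]) ->
  f @ F --> l.
Proof.
move=> FF Fx x01 ql fq; apply/cvgrPdist_lt => e e0.
have near_l (k : 'I_n) : \forall y \near F, k%:R / n%:R <= x <= k.+1%:R / n%:R ->
    `|l - (q k).[y]| < e.
  have [xk|_] := boolP (k%:R / n%:R <= x <= k.+1%:R / n%:R); last exact: nearW.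
  have c : (q k).[y] @[y --> F] --> l.
    rewrite -(ql k) //; apply: cvg_trans (@continuous_horner _ (q k) x).
    by apply: cvg_app; apply: cvg_trans Fx _; exact: cvg_within.
  by move/cvgrPdist_lt : c => /(_ e e0); apply: filterS.
have all_l := filter_forall _ near_l; have near_x := Fx _ (near_piece x01).
near=> y.
have [k kn [xk yk]] : exists2 k, (k < n)%N & k%:R / n%:R <= x <= k.+1%:R / n%:R
    /\ k%:R / n%:R <= y <= k.+1%:R / n%:R by near: y; exact: near_x.
have -> : f y = (q k).[y] by move: xk yk; move: (k) kn; near: y; exact: fq.
have h : forall i : 'I_n, i%:R / n%:R <= x <= i.+1%:R / n%:R -> `|l - (q i).[y]| < e.
  by near: y; exact: all_l.
exact: (h (Ordinal kn)).
Unshelve. all: by end_near.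
Qed.

Lemma on_pieces_continuous q f : on_pieces q f -> {within `[0, 1], continuous f}.
Proof.
move=> fq; apply/continuous01P => x x01; apply: (on_pieces_cvg (q := q)) => //.
  by move=> k kn xk; rewrite (fq k).
by apply: nearW => y k kn xk yk; exact: fq.
Qed.

Definition matching q := forall k, (k.+1 < n)%N ->
  (q k).[k.+1%:R / n%:R] = (q k.+1).[k.+1%:R / n%:R].

Lemma matching_eq q k l x : matching q -> (k < n)%N -> (l < n)%N ->
  k%:R / n%:R <= x <= k.+1%:R / n%:R -> l%:R / n%:R <= x <= l.+1%:R / n%:R ->
  (q k).[x] = (q l).[x].
Proof.
have n0 : 0 < n%:R^-1 :> R by rewrite invr_gt0 ltr0n.
move=> mq; wlog kl : k l / (k < l)%N.
  move=> H kn ln xk xl; have [kl|lk|->] := ltngtP k l => //; first exact: H.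
  by symmetry; apply: H.
move=> kn ln /andP[_ h1] /andP[h2 _].
have : l%:R / n%:R <= k.+1%:R / n%:R :> R by exact: le_trans h1.
rewrite ler_pM2r // ler_nat => lk.
(* Two distinct pieces sharing [x] are consecutive, and [x] is the breakpoint between them. *)
have {kl lk} ek : l = k.+1 by lia.
subst l; have -> : x = k.+1%:R / n%:R by apply/le_anti; rewrite h1.
exact: mq.
Qed.

(** Away from [x] the difference quotient is itself piecewise polynomial, so [on_pieces_cvg] gives
    its limit. *)
Lemma on_pieces_diffq q f x (d : R) : on_pieces q f -> 0 <= x <= 1 ->
  (forall k, (k < n)%N -> k%:R / n%:R <= x <= k.+1%:R / n%:R -> (q k)^`().[x] = d) ->
  diffq f x @ nbhs01 x --> d.
Proof.
move=> fq x01 qd.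
(* [r l] is the difference quotient of [q l] at [x] as a polynomial. *)
pose r l := (q l - (q l).[x]%:P) %/ ('X - x%:P).
have rE l : q l = r l * ('X - x%:P) + (q l).[x]%:P.
  by rewrite divpK ?subrK // dvdp_XsubCl /root !hornerE subrr.
have rx l : (r l).[x] = (q l)^`().[x].
  by rewrite [in RHS]rE derivD derivC addr0 derivM derivXsubC !hornerE subrr mulr0 add0r.
apply: (on_pieces_cvg (q := r)) => //.
- move=> A xA; have h : nbhs x (fun y => y \in `[0, 1] -> A y) by exact: xA.
  suff : nbhs x (fun y => y != x -> y \in `[0, 1] -> A y) by [].
  by apply: filterS h => y yA _.
- exact: x01.
- by move=> l ln xl; rewrite rx; apply: qd.
have neq_x : \forall y \near nbhs01 x, y != x.
  suff : nbhs x (fun y => y != x -> y \in `[0, 1] -> y != x) by [].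
  by apply: (@filterE _ (nbhs x)) => y yx _; exact: yx.
near=> y => l ln xl yl; rewrite /diffq (fq l) // (fq l x) //.
have yx : y - x != 0.
  rewrite subr_eq0; near: y; exact: neq_x.
by rewrite [in LHS]rE !hornerE; field.
Unshelve. all: by end_near.
Qed.

Lemma on_pieces_diffq_matching q f x k : on_pieces q f -> matching (deriv \o q) ->
  (k < n)%N -> k%:R / n%:R <= x <= k.+1%:R / n%:R ->
  diffq f x @ nbhs01 x --> (q k)^`().[x].
Proof.
move=> fq mq kn xk; apply: on_pieces_diffq fq (piece01 kn xk) _ => l ln xl.
exact: (matching_eq (q := deriv \o q) mq).
Qed.

(** An interior point lies on a single piece, so this also serves [p = 1], where derivatives may
    jump at the breakpoints. *)
Lemma on_pieces_der_open q f x k : on_pieces q f -> (k < n)%N ->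
  k%:R / n%:R < x < k.+1%:R / n%:R -> der f x = (q k)^`().[x].
Proof.
move=> fq kn /andP[kx xk]; have x01 : 0 <= x <= 1 by apply: (piece01 kn); rewrite !ltW.
apply: (der_cvg x01); apply: (on_pieces_diffq fq x01) => l ln /andP[lx xl].
have n0 : 0 < n%:R^-1 :> R by rewrite invr_gt0 ltr0n.
have := lt_le_trans kx xl; have := le_lt_trans lx xk.
by rewrite !ltr_pM2r // !ltr_nat => h1 h2; congr (_^`().[_]); congr q; lia.
Qed.

Lemma on_pieces_der q f : on_pieces q f -> matching (deriv \o q) ->
  on_pieces (deriv \o q) (der f).
Proof.
move=> fq mq k x kn xk; apply: der_cvg (piece01 kn xk) _.
exact: on_pieces_diffq_matching.
Qed.

Lemma on_pieces_dern q f m : on_pieces q f ->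
  (forall j, (j <= m)%N -> matching (derivn j \o q)) ->
  forall j, (j <= m)%N -> on_pieces (derivn j \o q) (dern j f).
Proof.
move=> fq mq; elim=> [//|j IH] jm k x kn xk.
have := on_pieces_der (IH (ltnW jm)); apply => //.
exact: (mq j.+1).
Qed.

Lemma on_pieces_Ck q f m : on_pieces q f ->
  (forall j, (j <= m)%N -> matching (derivn j \o q)) -> Ck01 m f.
Proof.
move=> fq mq; have D := on_pieces_dern fq mq; split; last first.
  by apply: on_pieces_continuous; exact: D.
move=> j x jm x01; have [k kn xk] := piece_ex x01.
apply/cvg_ex; eexists; apply: (on_pieces_diffq_matching (D j (ltnW jm)) _ kn xk).
exact: (mq j.+1).
Qed.
End Pieces.

(** * B-splines of the open uniform knot vector *)

Section Bsplines.
Variables (R : realType) (p n : nat).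
Hypotheses (p_gt0 : (0 < p)%N) (n_gt0 : (0 < n)%N).
Let t : nat -> R := knot R p n.

Lemma knot_mono : {homo t : i j / (i <= j)%N >-> i <= j}.
Proof.
by move=> i j ij; rewrite /t /knot ler_pM2r ?invr_gt0 ?ltr0n // ler_nat; lia.
Qed.

(** The [p] additional copies of the knot 0 shift the indices: piece [k] of the partition is knot
    span [k + p]. *)
Lemma knot_addr k : (k <= n)%N -> t (k + p) = k%:R / n%:R.
Proof. by move=> kn; rewrite /t /knot addnK (minn_idPl kn). Qed.

Lemma knot_le1 i : t i <= 1.
Proof. by rewrite /t /knot ler_pdivrMr ?ltr0n // mul1r ler_nat geq_minr. Qed.

Lemma knot_lt k : (k < n)%N -> t (k + p) < t (k + p).+1.
Proof.
move=> kn; rewrite -addSn !knot_addr ?(ltnW kn) //.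
by rewrite ltr_pM2r ?invr_gt0 ?ltr0n // ltr_nat.
Qed.

(** The second alternative is the last span, closed at 1. *)
Lemma cox_de_boorE q i k x : (k < n)%N ->
  k%:R / n%:R <= x < k.+1%:R / n%:R \/ k.+1 = n /\ x = 1 ->
  cox_de_boor p n q i x = (bpiece t (k + p) q i).[x].
Proof.
have n0 : (n%:R : R) != 0 by rewrite pnatr_eq0 -lt0n.
move=> kn kx; elim: q i => [|q IH] i; last first.
  rewrite bpieceS [LHS]/= !IH -/t. move: (bpiece t (k + p) q) => f.
  rewrite !(hornerD, hornerZ, hornerM, hornerN, hornerX, hornerC); ring.
have bE (b : bool) : (b%:R : {poly R}).[x] = b%:R by case: b; rewrite !hornerE.
rewrite /= bE -/t.
have kt : t (k + p) = k%:R / n%:R by rewrite knot_addr // ltnW.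
have kt1 : t (k + p).+1 = k.+1%:R / n%:R by rewrite -addSn knot_addr.
have lt := knot_lt kn.
have [->|ne] := eqVneq i (k + p)%N.
  rewrite kt kt1; case: kx => [-> //|[kn1 ->]].
  rewrite -kt -kt1 lt [in t _.+1]kt1 kn1 divff // eqxx !andbT orbT //.
(* Span [i] lies to the left or to the right of piece [k]; both alternatives of the indicator are
   refuted on each side. *)
rewrite ifF //; apply/negP => H.
have [lti|gti] := ltnP i (k + p).
  have h1 : t i.+1 <= k%:R / n%:R by rewrite -kt knot_mono.
  have h2 : k%:R / n%:R <= x.
    by case: kx => [/andP[]//|[_ ->]]; rewrite -kt knot_le1.
  have h3 : k%:R / n%:R < 1 :> R by rewrite -kt (lt_le_trans lt) ?knot_le1.
  by case/orP: H => [/andP[_ ?]|/and3P[_ /eqP ? _]]; lra.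
have h1 : k.+1%:R / n%:R <= t i by rewrite -kt1 knot_mono //; lia.
have h2 := knot_le1 i.+1.
have h3 := knot_le1 i.
case: kx => [/andP[_ xk]|[kn1 x1]].
  by case/orP: H => [/andP[h _]|/and3P[_ _ /eqP ?]]; lra.
subst x; have h4 : 1 <= t i by rewrite (le_trans _ h1) // kn1 divff.
by case/orP: H => [/andP[_ ?]|/and3P[? _ _]]; lra.
Qed.

Definition bspline_piece i k : {poly R} := bpiece t (k + p) p i.

Lemma bspline_matching i j : (j <= p.-1)%N ->
  matching n (derivn j \o bspline_piece i).
Proof.
move=> jp k kn; have lt1 : t (k + p).+1 < t (k + p).+2 by rewrite -addSn knot_lt.
have := bpiece_match knot_mono (knot_lt (ltnW kn)) lt1 i jp.
by rewrite prednK // -addSn knot_addr // ltnW.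
Qed.

(** The recursion evaluates an interior breakpoint on the span to its right; [bspline_matching] with
    no derivative carries the value over to the piece on its left. *)
Lemma bspline_on_pieces i : on_pieces n (bspline_piece i) (cox_de_boor p n p i).
Proof.
move=> k x kn /andP[kx xk].
have [xlt|xge] := ltrP x (k.+1%:R / n%:R).
  by rewrite (cox_de_boorE p i kn) //; left; rewrite kx.
have xE : x = k.+1%:R / n%:R by apply/le_anti; rewrite xk.
have [kn1|kn1] := eqVneq k.+1 n.
  rewrite (cox_de_boorE p i kn) //; right; split => //.
  by rewrite xE kn1 divff // pnatr_eq0 -lt0n.
have k1n : (k.+1 < n)%N by lia.
rewrite (cox_de_boorE p i k1n); last first.
  by left; rewrite xE lexx /= ltr_pM2r ?invr_gt0 ?ltr0n // ltr_nat //.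
by have := bspline_matching i (leq0n _) k1n; rewrite /= -xE => ->.
Qed.

Lemma cox_de_boor_spline i : spline p n (cox_de_boor p n p i : R -> R).
Proof.
split; first by apply: on_pieces_Ck (bspline_on_pieces i) (bspline_matching i).
move=> k kn; exists (bspline_piece i k); split; first exact: size_bpiece.
by move=> x; apply: bspline_on_pieces.
Qed.

Lemma poly0_interval (q : {poly R}) (a b : R) : a < b ->
  (forall x, a <= x <= b -> q.[x] = 0) -> q = 0.
Proof.
move=> ab q0; apply/eqP; apply: contraT => qn0.
(* These are [size q] distinct points of the interval, one root more than the degree of [q]
   allows. *)
pose r i := a + (b - a) * (i%:R / (size q)%:R).
have sq : 0 < (size q)%:R :> R by rewrite ltr0n size_poly_gt0.
have := max_poly_roots (rs := [seq r i | i <- iota 0 (size q)]) qn0.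
rewrite size_map size_iota ltnn; apply => //.
  apply/allP => _ /mapP[i + ->]; rewrite mem_iota => /andP[_ iq].
  have i1 : i%:R / (size q)%:R <= 1 :> R.
    by rewrite ler_pdivrMr // mul1r ler_nat ltnW.
  have i0 : 0 <= i%:R / (size q)%:R :> R by rewrite divr_ge0.
  by apply/rootP/q0; rewrite /r; nra.
rewrite map_inj_uniq ?iota_uniq // => i j /addrI/mulfI h.
have := h _; rewrite subr_eq0 gt_eqF // => /(_ isT)/divIf.
by rewrite gt_eqF // => /(_ isT)/eqP; rewrite eqr_nat => /eqP.
Qed.

Lemma cox_de_boor_free (a : nat -> R) :
  (forall x, 0 <= x <= 1 -> \sum_(i < n + p) a i * cox_de_boor p n p i x = 0) ->
  forall i, (i < n + p)%N -> a i = 0.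
Proof.
(* With this [k], [i <= k + p <= i + p]: span [k + p] lies in the support of the [i]-th B-spline,
   and [bpiece_free] on that span gives [a i = 0]. *)
move=> a0 i inp; pose k := minn i n.-1.
have kn : (k < n)%N by rewrite /k; lia.
apply: (bpiece_free knot_mono (knot_lt kn) (q := p) (a := a)); last 2 first.
- suff -> : \sum_(i0 < (k + p).+1) a i0 *: bpiece t (k + p) p i0
    = \sum_(i0 < n + p) a i0 *: bpiece t (k + p) p i0.
    have lt := knot_lt kn; apply: (poly0_interval lt) => x.
    rewrite -addSn !knot_addr // 1?ltnW // => xk.
    rewrite -[RHS](a0 x); last exact: piece01 xk.
    rewrite horner_sum; apply: eq_bigr => j _; rewrite hornerZ.
    by rewrite (bspline_on_pieces j kn xk).
  rewrite (big_ord_widen (n + p)%N (fun i => a i *: bpiece t (k + p) p i)); last by lia.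
  rewrite [RHS](bigID (fun j : 'I_(n + p) => (j < (k + p).+1)%N)) /= [X in _ + X]big1 ?addr0 //.
  by move=> j jk; rewrite bpiece_out ?scaler0 //; lia.
- rewrite /k; lia.
by rewrite leq_addl.
Qed.
End Bsplines.

(** * Integration of piecewise polynomials *)

Section PiecewisePoly.
Variables (R : realType) (n : nat).
Hypothesis n_gt0 : (0 < n)%N.
Implicit Types (f g : R -> R) (x : R).
Local Notation mu := (@lebesgue_measure R).

(** Values at the breakpoints are unconstrained: for [p = 1] the derivative of a
    B-spline is arbitrary there. *)
Definition piecewise_poly f : Prop := exists q : nat -> {poly R},
  forall k x, (k < n)%N -> k%:R / n%:R < x < k.+1%:R / n%:R -> f x = (q k).[x].

Definition breaks : set R := (fun k : nat => k%:R / n%:R) @` `I_n.+1.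

Lemma breaks_countable : countable breaks.
Proof. exact/finite_set_countable/finite_image/finite_II. Qed.

Lemma measurable_breaks : measurable breaks.
Proof. by apply: countable_measurable breaks_countable => x; exact: measurable_set1. Qed.

Lemma breaks0 : mu breaks = 0%E.
Proof. exact: countable_lebesgue_measure0 breaks_countable. Qed.

Lemma open_piece_ex x : (`[0, 1] `\` breaks) x ->
  exists2 k, (k < n)%N & k%:R / n%:R < x < k.+1%:R / n%:R.
Proof.
move=> [/= x01 xb]; rewrite in_itv /= in x01.
have [k kn /andP[kx xk]] := piece_ex n_gt0 x01; exists k => //.
rewrite !lt_neqAle kx xk !andbT; apply/andP; split; apply/eqP => e; apply: xb.
  by exists k => //=; exact: ltnW.
by exists k.+1.
Qed.

(** Off the null set [breaks], [f] equals the sum [g] of its polynomials cut off to the open pieces,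
    and [g] is integrable. *)
Lemma piecewise_poly_mfun f : piecewise_poly f ->
  measurable_fun (`[0, 1] : set R) f /\ mu.-integrable `[0, 1] (EFin \o f).
Proof.
move=> [q fq].
pose I (k : nat) : set R := [set` `]k%:R / n%:R, k.+1%:R / n%:R[].
pose g := \sum_(k < n) (horner (q k) \_ (I k)).
have int_g : mu.-integrable `[0, 1] (EFin \o g).
  rewrite (_ : EFin \o g = fun x => (\sum_(k < n) ((horner (q k) \_ (I k)) x)%:E)%E); last first.
    by apply/funext => x; rewrite /= /g fct_sumE sumEFin.
  apply: integrable_sum => // k _.
  rewrite (_ : (fun _ => _) = (EFin \o horner (q k)) \_ (I k)); last first.
    by apply/funext => x; rewrite /= /patch; case: ifP.
  have mI : measurable (I k) by exact: measurable_itv.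
  apply/integrable_restrict => //.
  have int_q : mu.-integrable `[0, 1] (EFin \o horner (q k)).
    apply: continuous_compact_integrable; first exact: segment_compact.
    by apply: continuous_subspaceT => x; exact: continuous_horner.
  by apply: integrableS int_q => //; exact: measurableI.
have eq_fg : {in `[0, 1] `\` breaks, (EFin \o g) =1 (EFin \o f)}.
  move=> x /set_mem/open_piece_ex[k kn xk] /=; rewrite (fq k) // /g fct_sumE.
  rewrite (bigD1 (Ordinal kn)) //= big1 ?addr0.
    by rewrite /patch ifT // inE /I /= in_itv.
  move=> l lk; rewrite /patch ifF //; apply/negP; rewrite inE /I /= in_itv /= => xl.
  have n0 : 0 < n%:R^-1 :> R by rewrite invr_gt0 ltr0n.
  have lt a b : a%:R / n%:R < x < a.+1%:R / n%:R -> b%:R / n%:R < x < b.+1%:R / n%:R ->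
      (a <= b)%N.
    move=> /andP[xa _] /andP[_ xb]; have := lt_trans xa xb.
    by rewrite ltr_pM2r // ltr_nat.
  by case/eqP: lk; apply/val_inj/anti_leq; rewrite /= !(lt l k, lt k l).
have mD : measurable (`[0, 1] `\` breaks : set R).
  by apply: measurableD => //; exact: measurable_breaks.
have int_f : mu.-integrable (`[0, 1] `\` breaks) (EFin \o f).
  apply: (@eq_integrable _ _ _ mu _ mD (EFin \o g)); first exact: eq_fg.
  by apply: integrableS int_g => //; exact: subDsetl.
have mf : measurable_fun (`[0, 1] : set R) f.
  rewrite -(setUIDK `[0, 1] breaks); apply/measurable_funU => //.
    by apply: measurableI => //; exact: measurable_breaks.
  split; last first.
    by move/(measurable_int mu)/measurable_EFinP : int_f.
  (* Within [breaks] every preimage is countable, hence measurable. *)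
  move=> mI Y mY; apply: countable_measurable; first by move=> x; exact: measurable_set1.
  by apply: sub_countable breaks_countable; apply: subset_card_le => x [[]].
have mI : measurable (`[0, 1] : set R) by [].
have mf' := (measurable_EFinP _ _).2 mf.
by split => //; apply/(@negligible_integrable _ _ _ mu _ _ _ measurable_breaks mI mf' breaks0).
Qed.

Lemma piecewise_poly_lin f g (a : R) : piecewise_poly f -> piecewise_poly g ->
  piecewise_poly (fun x => a * f x + g x).
Proof.
move=> [q fq] [r gr]; exists (fun k => a *: q k + r k) => k x kn xk.
by rewrite (fq k) // (gr k) // !hornerE.
Qed.

Lemma piecewise_polyM f g : piecewise_poly f -> piecewise_poly g ->
  piecewise_poly (fun x => f x * g x).
Proof.
move=> [q fq] [r gr]; exists (fun k => q k * r k) => k x kn xk.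
by rewrite (fq k) // (gr k) // !hornerE.
Qed.

Lemma eq_piecewise_poly f g :
  (forall k x, (k < n)%N -> k%:R / n%:R < x < k.+1%:R / n%:R -> f x = g x) ->
  piecewise_poly f -> piecewise_poly g.
Proof. by move=> fg [q fq]; exists q => k x kn xk; rewrite -(fg k) // (fq k). Qed.

Lemma eq_Rintegral_pieces f g : piecewise_poly f ->
  (forall k x, (k < n)%N -> k%:R / n%:R < x < k.+1%:R / n%:R -> f x = g x) ->
  Rintegral mu `[0, 1] f = Rintegral mu `[0, 1] g.
Proof.
move=> pf fg; have pg := eq_piecewise_poly fg pf.
have [_ intf] := piecewise_poly_mfun pf; have [_ intg] := piecewise_poly_mfun pg.
have mb := measurable_breaks.
rewrite /Rintegral (@negligible_integral _ _ _ mu _ _ _ mb _ intf breaks0) //.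
rewrite (@negligible_integral _ _ _ mu _ _ _ mb _ intg breaks0) //.
congr fine; apply: eq_integral => x /set_mem /open_piece_ex[k kn xk].
by rewrite /= (fg k).
Qed.

Lemma L2dot_lin f g h (a : R) : piecewise_poly f -> piecewise_poly g ->
  piecewise_poly h ->
  L2dot (fun x => a * f x + g x) h = a * L2dot f h + L2dot g h.
Proof.
move=> pf pg ph.
have [_ ifh] := piecewise_poly_mfun (piecewise_polyM pf ph).
have [_ igh] := piecewise_poly_mfun (piecewise_polyM pg ph).
have iafh : mu.-integrable `[0, 1] (EFin \o (fun x => a * (f x * h x))).
  by apply: integrableZl ifh.
rewrite /L2dot -RintegralZl // -RintegralD //.
by apply: eq_Rintegral => x _; rewrite mulrDl mulrA.
Qed.
End PiecewisePoly.

(** * Spline spaces, coordinates and Gram matrices *)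

Section LinearSpaces.
Variables (R : realType) (p n : nat) (D : set R).
Hypotheses (n_gt0 : (0 < n)%N) (D01 : D `<=` [set 0; 1]).
Implicit Types v w : R -> R.

Definition linear_space (S : set (R -> R)) : Prop :=
  S (fun=> 0) /\
  forall (a : R) v w, S v -> S w -> S (fun x => a * v x + w x).

Lemma linear_space_sum (S : set (R -> R)) k (a : 'I_k -> R) (f : 'I_k -> R -> R) :
  linear_space S -> (forall j, S (f j)) -> S (fun x => \sum_j a j * f j x).
Proof.
move=> [S0 SD] Sf; elim: (index_enum _) => [|j s IH].
  by rewrite (_ : (fun _ => _) = fun=> 0) //; apply/funext => x; rewrite big_nil.
rewrite (_ : (fun _ => _) = fun x => a j * f j x + \sum_(j <- s) a j * f j x).
  exact: SD.
by apply/funext => x; rewrite big_cons.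
Qed.

Lemma spline_linear : linear_space (spline p n : set (R -> R)).
Proof.
split.
  split; first exact: Ck01_0.
  by move=> k kn; exists 0; rewrite size_poly0; split => // x _; rewrite horner0.
move=> a v w [Cv pv] [Cw pw]; split; first exact: Ck01_lin.
move=> k kn; have [q [sq vq]] := pv k kn; have [r [sr wr]] := pw k kn.
exists (a *: q + r); split; last by move=> x xk; rewrite vq // wr // !hornerE.
apply: leq_trans (size_polyD _ _) _; rewrite geq_max sr andbT.
exact: leq_trans (size_scale_leq _ _) sq.
Qed.

Lemma splineD_linear : linear_space (splineD p n D).
Proof.
have [S0 SL] := spline_linear; split; first by split.
move=> a v w [Sv v0] [Sw w0]; split; first exact: SL.
by move=> x Dx; rewrite v0 // w0 // mulr0 addr0.
Qed.

Let end01 (x : R) : [set 0; 1] x -> 0 <= x <= 1.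
Proof. by case=> ->; rewrite ?lexx ?ler01. Qed.

(** The boundary conditions involve derivatives of order at most [p.-1], for which [dern_lin]
    applies to splines. *)
Lemma spline_reg_linear : linear_space (spline_reg p n D).
Proof.
have [S0 SL] := splineD_linear; split.
  split=> // [k x _ Dx|k x _ [x01 _]]; apply: dern0; [exact/end01/D01|exact: end01].
move=> a v w [Sv v1 v2] [Sw w1 w2]; split; first exact: SL.
  move=> k x kp Dx; rewrite (dern_lin a Sv.1.1 Sw.1.1).
  - by rewrite v1 // w1 // mulr0 addr0.
  - lia.
  - exact/end01/D01.
move=> k x kp Dx; rewrite (dern_lin a Sv.1.1 Sw.1.1).
- by rewrite v2 // w2 // mulr0 addr0.
- lia.
- by apply: end01; case: Dx.
Qed.
End LinearSpaces.

Section Gram.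
Variables (R : realType) (n : nat).
Hypothesis n_gt0 : (0 < n)%N.
Implicit Types f g h : R -> R.

Lemma L2dotC f g : L2dot f g = L2dot g f.
Proof. by apply: eq_Rintegral => x _; rewrite mulrC. Qed.

Lemma eq_L2dot f f' g g' : (forall x, 0 <= x <= 1 -> f x = f' x) ->
  (forall x, 0 <= x <= 1 -> g x = g' x) -> L2dot f g = L2dot f' g'.
Proof.
move=> ff gg; apply: eq_Rintegral => x; rewrite inE /= in_itv /= => x01.
by rewrite ff // gg.
Qed.

Lemma L2dot_ge0 f : 0 <= L2dot f f.
Proof. by apply: Rintegral_ge0 => x _; rewrite -expr2 sqr_ge0. Qed.

Lemma H1semi_sqr f : H1semi f ^+ 2 = L2dot (der f) (der f).
Proof. by rewrite sqr_sqrtr // L2dot_ge0. Qed.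

Lemma piecewise_poly_sum k (a : 'I_k -> R) (f : 'I_k -> R -> R) :
  (forall j, piecewise_poly n (f j)) -> piecewise_poly n (fun x => \sum_j a j * f j x).
Proof.
move=> pf; apply: (@linear_space_sum _ (@piecewise_poly R n)) => //.
split=> [|b v w]; last exact: piecewise_poly_lin.
by exists (fun=> 0) => *; rewrite horner0.
Qed.

Lemma L2dot_suml k (a : 'I_k -> R) (f : 'I_k -> R -> R) g :
  (forall j, piecewise_poly n (f j)) -> piecewise_poly n g ->
  L2dot (fun x => \sum_j a j * f j x) g = \sum_j a j * L2dot (f j) g.
Proof.
move=> pf pg.
suff : forall s : seq 'I_k, piecewise_poly n (fun x => \sum_(j <- s) a j * f j x) /\
    L2dot (fun x => \sum_(j <- s) a j * f j x) g = \sum_(j <- s) a j * L2dot (f j) g.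
  by case/(_ (index_enum _)).
elim=> [|j s [ps IH]].
  under eq_fun do rewrite big_nil; rewrite big_nil; split.
    by exists (fun=> 0) => *; rewrite horner0.
  rewrite /L2dot (_ : (fun _ => _) = cst 0); first by rewrite /Rintegral integral0.
  by apply/funext => x; rewrite mul0r.
under eq_fun do rewrite big_cons; rewrite big_cons; split.
  exact: piecewise_poly_lin.
by rewrite (L2dot_lin n_gt0) // IH.
Qed.

Lemma L2dot_gram k (F : 'I_k -> R -> R) (a b : 'cV[R]_k) :
  (forall j, piecewise_poly n (F j)) ->
  L2dot (fun x => \sum_j a j 0 * F j x) (fun x => \sum_i b i 0 * F i x)
  = (b^T *m (\matrix_(i, j) L2dot (F j) (F i)) *m a) 0 0.
Proof.
move=> pF; rewrite L2dot_suml //; last exact: piecewise_poly_sum.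
rewrite mxE; apply: eq_bigr => j _; rewrite mulrC; congr (_ * _).
rewrite L2dotC L2dot_suml // mxE; apply: eq_bigr => i _.
by rewrite !mxE L2dotC.
Qed.
End Gram.

Section Coordinates.
Variables (R : realType) (p n : nat) (D : set R).
Hypotheses (p_gt0 : (0 < p)%N) (n_gt0 : (0 < n)%N).
Local Notation M := (massmx p n D).
Local Notation K := (stiffmx p n D).

Definition of_cvec (a : 'cV[R]_(mdim p n D)) : R -> R := fun x => \sum_i a i 0 * bspline i x.

Lemma of_cvec_mulmx k (V : 'M[R]_(mdim p n D, k)) (a : 'cV[R]_k) x :
  of_cvec (V *m a) x = \sum_j a j 0 * of_coord V j x.
Proof.
rewrite /of_cvec /of_coord; under [RHS]eq_bigr do rewrite big_distrr /=.
rewrite exchange_big /=; apply: eq_bigr => i _; rewrite mxE big_distrl /=.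
by apply: eq_bigr => j _; rewrite mulrA [a j 0 * _]mulrC.
Qed.

Lemma of_coordE k (V : 'M[R]_(mdim p n D, k)) j : of_coord V j = of_cvec (col j V).
Proof. by apply/funext => x; apply: eq_bigr => i _; rewrite mxE. Qed.

Lemma of_cvecD a b x : of_cvec (a + b) x = of_cvec a x + of_cvec b x.
Proof. by rewrite /of_cvec -big_split /=; apply: eq_bigr => i _; rewrite mxE mulrDl. Qed.

Lemma of_cvec_splineD a : splineD p n D (of_cvec a).
Proof.
apply: linear_space_sum (splineD_linear p n D) _ => j; split.
  exact: cox_de_boor_spline.
by move=> x Dx; have := enum_valP j; rewrite inE => /asboolP; apply.
Qed.

Lemma of_cvec_inj a b : (forall x, 0 <= x <= 1 -> of_cvec a x = of_cvec b x) -> a = b.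
Proof.
move=> ab; apply/colP => j; apply/eqP; rewrite -subr_eq0; apply/eqP.
(* [c] extends the coefficient differences by 0 to the removed B-splines, so that freeness of the
   full family applies. *)
pose c (i : nat) : R := \sum_(l < mdim p n D | enum_val l == i :> nat) (a l 0 - b l 0).
have cE : c (enum_val j) = a j 0 - b j 0.
  rewrite /c (bigD1 j) //= big1 ?addr0 // => l /andP[/eqP e]; case/eqP.
  exact/enum_val_inj/val_inj.
rewrite -cE; apply: (cox_de_boor_free p_gt0 n_gt0) => // x x01.
transitivity (of_cvec a x - of_cvec b x); last by rewrite ab ?subrr.
rewrite /of_cvec -sumrB /c; under eq_bigr do rewrite big_distrl /=.
rewrite (exchange_big_dep xpredT) //=; apply: eq_bigr => l _.
by rewrite (big_pred1 (enum_val l)) ?mulrBl.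
Qed.

Lemma bspline_der_open (j : 'I_(mdim p n D)) k x : (k < n)%N -> k%:R / n%:R < x < k.+1%:R / n%:R ->
  der (bspline j) x = (bspline_piece R p n (enum_val j) k)^`().[x].
Proof. by apply: (on_pieces_der_open n_gt0); exact: bspline_on_pieces. Qed.

Lemma bspline_piecewise (j : 'I_(mdim p n D)) : piecewise_poly n (bspline j).
Proof.
exists (bspline_piece R p n (enum_val j)) => k x kn /andP[kx xk].
by apply: bspline_on_pieces => //; rewrite !ltW.
Qed.

Lemma der_bspline_piecewise (j : 'I_(mdim p n D)) : piecewise_poly n (der (bspline j)).
Proof.
by exists (deriv \o bspline_piece R p n (enum_val j)) => k x kn; exact: bspline_der_open.
Qed.

(** For [p = 1] the limits defining [der] may not exist at breakpoints, so linearity is claimed on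
    open pieces only; integrals see nothing else. *)
Lemma der_of_cvec a k x : (k < n)%N -> k%:R / n%:R < x < k.+1%:R / n%:R ->
  der (of_cvec a) x = \sum_j a j 0 * der (bspline j) x.
Proof.
move=> kn xk.
pose q k := \sum_(j < mdim p n D) a j 0 *: bspline_piece R p n (enum_val j) k.
rewrite (on_pieces_der_open n_gt0 (q := q) _ kn xk).
  rewrite /q linear_sum horner_sum; apply: eq_bigr => j _.
  by rewrite linearZ hornerZ (bspline_der_open _ kn xk).
move=> l y ln yl; rewrite /of_cvec horner_sum; apply: eq_bigr => j _.
by rewrite hornerZ; congr (_ * _); apply: bspline_on_pieces.
Qed.

Lemma L2dot_of_cvec a b : L2dot (of_cvec a) (of_cvec b) = (b^T *m M *m a) 0 0.
Proof. by apply: (L2dot_gram n_gt0 a b (F := @bspline R p n D)) => j; exact: bspline_piecewise. Qed.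

Lemma H1semi_of_cvec a : H1semi (of_cvec a) ^+ 2 = (a^T *m K *m a) 0 0.
Proof.
rewrite H1semi_sqr -(L2dot_gram n_gt0 a a (F := fun j => der (bspline j))); last first.
  exact: der_bspline_piecewise.
have pD : piecewise_poly n (fun x => \sum_j a j 0 * der (bspline j) x).
  by apply: piecewise_poly_sum; exact: der_bspline_piecewise.
symmetry; apply: (eq_Rintegral_pieces n_gt0); first exact: piecewise_polyM.
by move=> k x kn xk; rewrite (der_of_cvec _ kn xk).
Qed.
End Coordinates.

Lemma mulmx_col_entry (R : pzRingType) m k l (A : 'M[R]_m) (U : 'M[R]_(m, k)) (V : 'M[R]_(m, l)) i j :
  ((col i U)^T *m A *m col j V) 0 0 = (U^T *m A *m V) i j.
Proof. by rewrite tr_col colE !mulmxA -!row_mul -colE !mxE. Qed.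

(** * The orthogonal splitting and its eigenbasis *)

Section Splitting.
Variables (R : realType) (p n : nat) (D : set R).
Hypotheses (p_gt0 : (0 < p)%N) (n_gt0 : (0 < n)%N) (D01 : D `<=` [set 0; 1]).
Variables (nreg nout : nat).
Variables (Vreg : 'M[R]_(mdim p n D, nreg)) (Vout : 'M[R]_(mdim p n D, nout)).
Hypothesis Vreg_basis : is_basis (spline_reg p n D) (of_coord Vreg).
Hypothesis Vout_basis : is_basis (spline_out p n D) (of_coord Vout).
Local Notation M := (massmx p n D).
Local Notation K := (stiffmx p n D).

Lemma spline_regP w : spline_reg p n D w ->
  exists a, forall x, 0 <= x <= 1 -> w x = of_cvec (Vreg *m a) x.
Proof.
case: Vreg_basis => _ _ span /span[a wa]; exists (\col_j a j) => x x01.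
by rewrite wa // of_cvec_mulmx; apply: eq_bigr => j _; rewrite mxE.
Qed.

Lemma spline_outP w : spline_out p n D w ->
  exists a, forall x, 0 <= x <= 1 -> w x = of_cvec (Vout *m a) x.
Proof.
case: Vout_basis => _ _ span /span[a wa]; exists (\col_j a j) => x x01.
by rewrite wa // of_cvec_mulmx; apply: eq_bigr => j _; rewrite mxE.
Qed.

Lemma of_cvec_reg a : spline_reg p n D (of_cvec (Vreg *m a)).
Proof.
case: Vreg_basis => Vr _ _; rewrite (_ : of_cvec _ = fun x => \sum_j a j 0 * of_coord Vreg j x).
  by apply: linear_space_sum Vr; exact: spline_reg_linear.
by apply/funext => x; rewrite of_cvec_mulmx.
Qed.

Lemma orth_out_reg : Vreg^T *m M *m Vout = 0.
Proof.
case: Vreg_basis => Vr _ _; case: Vout_basis => Vo _ _.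
apply/matrixP => i j; rewrite [RHS]mxE -[RHS]((Vo j).2 _ (Vr i)).
by rewrite !of_coordE L2dot_of_cvec // mulmx_col_entry.
Qed.

Lemma orth_reg_out : Vout^T *m M *m Vreg = 0.
Proof.
case: Vreg_basis => Vr _ _; case: Vout_basis => Vo _ _.
apply/matrixP => i j; rewrite [RHS]mxE -[RHS]((Vo i).2 _ (Vr j)) L2dotC.
by rewrite !of_coordE L2dot_of_cvec // mulmx_col_entry.
Qed.

(** The columns of [Vreg] span S^reg, so orthogonality to them is orthogonality to the whole
    space. *)
Lemma of_cvec_out r : Vreg^T *m M *m r = 0 -> spline_out p n D (of_cvec r).
Proof.
move=> r0; split; first exact: of_cvec_splineD.
move=> w /spline_regP[a wa].
rewrite (eq_L2dot (f' := of_cvec r) (g' := of_cvec (Vreg *m a))) //.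
by rewrite L2dot_of_cvec // trmx_mul -!mulmxA (mulmxA _ M) r0 mulmx0 mxE.
Qed.

Section Eigen.
Variables (Qreg Lreg : 'M[R]_nreg) (Qout Lout : 'M[R]_nout).
Hypothesis eig_reg : gen_eigendecomp K M Vreg Qreg Lreg.
Hypothesis eig_out : gen_eigendecomp K M Vout Qout Lout.
Let Qt := row_mx (Vreg *m Qreg) (Vout *m Qout).

Lemma eigbasis_left_inv : Qt^T *m M *m Qt = 1%:M.
Proof.
case: eig_reg => _ _ Mreg; case: eig_out => _ _ Mout.
rewrite /Qt tr_row_mx mul_col_mx mul_col_row !trmx_mul.
have e1 : Qreg^T *m Vreg^T *m M *m (Vreg *m Qreg) = 1%:M.
  by rewrite -[RHS]Mreg !mulmxA.
have e2 : Qreg^T *m Vreg^T *m M *m (Vout *m Qout) = 0.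
  by rewrite !mulmxA -(mulmxA Qreg^T) -(mulmxA Qreg^T) orth_out_reg mulmx0 mul0mx.
have e3 : Qout^T *m Vout^T *m M *m (Vreg *m Qreg) = 0.
  by rewrite !mulmxA -(mulmxA Qout^T) -(mulmxA Qout^T) orth_reg_out mulmx0 mul0mx.
have e4 : Qout^T *m Vout^T *m M *m (Vout *m Qout) = 1%:M.
  by rewrite -[RHS]Mout !mulmxA.
by rewrite e1 e2 e3 e4 -scalar_mx_block.
Qed.

Lemma eigbasis_span (a : 'cV[R]_(mdim p n D)) : exists y, a = Qt *m y.
Proof.
case: eig_reg => _ _ Mreg; case: eig_out => _ _ Mout.
have invreg : Vreg^T *m M *m Vreg *m Qreg *m Qreg^T = 1%:M.
  by apply: mulmx1C; rewrite mulmxA.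
have invout : Qout *m (Qout^T *m (Vout^T *m M *m Vout)) = 1%:M.
  by apply: mulmx1C.
(* The columns of [Vreg *m Qreg] are [M]-orthonormal, so [y1] holds the coordinates of the
   orthogonal projection on S^reg. *)
pose y1 := Qreg^T *m Vreg^T *m M *m a.
have r0 : Vreg^T *m M *m (a - Vreg *m Qreg *m y1) = 0.
  by rewrite mulmxBr /y1 !mulmxA invreg mul1mx subrr.
have [b rb] := spline_outP (of_cvec_out r0).
have {}rb : a - Vreg *m Qreg *m y1 = Vout *m b by exact: of_cvec_inj rb.
(* [b] refers to the basis [Vout]; multiplying by the inverse of [Qout] found in [invout] passes to
   the eigenbasis. *)
exists (col_mx y1 (Qout^T *m (Vout^T *m M *m Vout) *m b)).
rewrite /Qt mul_row_col -(mulmxA Vout) (mulmxA Qout) invout mul1mx -rb.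
by rewrite addrC subrK.
Qed.

(** [Qt] is not known to be square beforehand: since it is onto and [Qt^T *m M] is a left inverse,
    [Qt *m (Qt^T *m M)] fixes every vector. *)
Lemma eigbasis_right_inv : Qt *m (Qt^T *m M) = 1%:M.
Proof.
have id (a : 'cV[R]_(mdim p n D)) : Qt *m (Qt^T *m M) *m a = a.
  have [y ->] := eigbasis_span a.
  by rewrite -mulmxA (mulmxA (Qt^T *m M)) eigbasis_left_inv mul1mx.
apply/matrixP => i j; have := congr1 (fun A : 'cV[R]_(mdim p n D) => A i 0) (id (delta_mx j 0)).
by rewrite -colE !mxE eqxx andbT.
Qed.
End Eigen.
End Splitting.

(** * Spectral equivalence of the two stiffness matrices *)

Theorem corollary1 (R : realType) (c C : R) (c_gt0 : 0 < c) (C_gt0 : 0 < C)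
  (stable : forall (p n : nat) (D : set R),
     (1 <= p)%N -> (1 <= n)%N -> D `<=` [set 0; 1] ->
     forall v vreg vout : R -> R,
       splineD p n D v -> spline_reg p n D vreg -> spline_out p n D vout ->
       (forall x : R, 0 <= x <= 1 -> v x = vreg x + vout x) ->
       c * (H1semi vreg ^+ 2 + H1semi vout ^+ 2) <= H1semi v ^+ 2 /\
       H1semi v ^+ 2 <= C * (H1semi vreg ^+ 2 + H1semi vout ^+ 2))
  (p n : nat) (D : set R)
  (p_ge1 : (1 <= p)%N) (n_ge1 : (1 <= n)%N) (D01 : D `<=` [set 0; 1])
  (nreg nout : nat)
  (Vreg : 'M[R]_(mdim p n D, nreg)) (Vout : 'M[R]_(mdim p n D, nout))
  (Vreg_basis : is_basis (spline_reg p n D) (of_coord Vreg))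
  (Vout_basis : is_basis (spline_out p n D) (of_coord Vout))
  (Qreg Lreg : 'M[R]_nreg) (Qout Lout : 'M[R]_nout)
  (eig_reg : gen_eigendecomp (stiffmx p n D) (massmx p n D) Vreg Qreg Lreg)
  (eig_out : gen_eigendecomp (stiffmx p n D) (massmx p n D) Vout Qout Lout) :
  let Qt : 'M[R]_(mdim p n D, nreg + nout) :=
    row_mx Vreg Vout *m block_mx Qreg 0 0 Qout in
  let Lt : 'M[R]_(nreg + nout) := block_mx Lreg 0 0 Lout in
  (* [Qt] is invertible, with inverse [Qi] *)
  exists Qi : 'M[R]_(nreg + nout, mdim p n D),
    [/\ Qt *m Qi = 1%:M, Qi *m Qt = 1%:M
      & let Kt : 'M[R]_(mdim p n D) := Qi^T *m Lt *m Qi in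
        forall v : 'cV[R]_(mdim p n D),
          c * (v^T *m Kt *m v) 0 0 <= (v^T *m stiffmx p n D *m v) 0 0 /\
          (v^T *m stiffmx p n D *m v) 0 0 <= C * (v^T *m Kt *m v) 0 0].
Proof.
move=> Qt Lt.
have QtE : Qt = row_mx (Vreg *m Qreg) (Vout *m Qout).
  by rewrite /Qt mul_row_block !mulmx0 addr0 add0r.
have left_inv := eigbasis_left_inv p_ge1 n_ge1 Vreg_basis Vout_basis eig_reg eig_out.
have right_inv := eigbasis_right_inv p_ge1 n_ge1 Vreg_basis Vout_basis eig_reg eig_out.
rewrite -QtE in left_inv right_inv.
exists (Qt^T *m massmx p n D); split=> // Kt v.
(* [y] holds the eigenbasis coordinates of [v]; its two blocks give the components in S^reg and
   S^out. *)
pose y := Qt^T *m massmx p n D *m v; pose y1 := usubmx y; pose y2 := dsubmx y.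
have vE : v = Vreg *m (Qreg *m y1) + Vout *m (Qout *m y2).
  by rewrite !mulmxA -mul_row_col vsubmxK -QtE /y !mulmxA -(mulmxA Qt) right_inv mul1mx.
have KtE : v^T *m Kt *m v = y1^T *m Lreg *m y1 + y2^T *m Lout *m y2.
  have -> : v^T *m Kt *m v = y^T *m Lt *m y.
    by rewrite /Kt /y; move: (Qt^T *m _) => W; rewrite trmx_mul !mulmxA.
  rewrite -(vsubmxK y) -/y1 -/y2 /Lt tr_col_mx mul_row_block !mulmx0 addr0 add0r.
  by rewrite mul_row_col.
(* Undoing the diagonalization turns the two diagonal forms into stiffness forms of the components,
   that is, into squared H1 seminorms. *)
case: eig_reg => _ Kreg _; case: eig_out => _ Kout _.
rewrite KtE -Kreg -Kout mxE.
have eq1 : y1^T *m (Qreg^T *m (Vreg^T *m stiffmx p n D *m Vreg) *m Qreg) *m y1 =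
    (Vreg *m (Qreg *m y1))^T *m stiffmx p n D *m (Vreg *m (Qreg *m y1)).
  by rewrite !trmx_mul !mulmxA.
have eq2 : y2^T *m (Qout^T *m (Vout^T *m stiffmx p n D *m Vout) *m Qout) *m y2 =
    (Vout *m (Qout *m y2))^T *m stiffmx p n D *m (Vout *m (Qout *m y2)).
  by rewrite !trmx_mul !mulmxA.
rewrite eq1 eq2 -!H1semi_of_cvec //.
apply: (stable p n D) => //.
- exact: of_cvec_splineD.
- exact: of_cvec_reg.
(* Membership in S^out follows from [M]-orthogonality to [Vreg], which all combinations of the
   columns of [Vout] inherit. *)
- apply: (of_cvec_out p_ge1 n_ge1 Vreg_basis).
  by rewrite mulmxA (orth_out_reg p_ge1 n_ge1 Vreg_basis Vout_basis) mul0mx.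
- by move=> x _; rewrite {1}vE of_cvecD.
Qed.
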